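(* Let $X$ be a finite quantum space of dimension $N:=\eta^\dagger\eta\neq3$ and let $H$ be a quantum Hadamard matrix on $X$. Then the associated quantum Hadamard graph is distance regular with diameter four, and its intersection array equals $(N,N-1,N/2,1;\,1,N/2,N-1,N)$.
   Context: All algebras are unital over $\mathbb C$. A finite quantum space $X$ is given by a finite-dimensional $*$-algebra $C(X)$ with a positive linear functional $\psi$ such that $(a,b)\mapsto\psi(ab)$ is non-degenerate, $\psi(ab)=\psi(ba)$, and $mm^\dagger=\mathrm{id}$, where $m$ is the multiplication and $\dagger$ is the adjoint with respect to $\langle a,b\rangle=\psi(a^*b)$ (and the induced inner product on tensor powers). $l^2(X)$ is $C(X)$ with this inner product; $\eta$ is the unit of $C(X)$ (as a map $\mathbb C\to l^2(X)$ or a vector), so $\eta^\dagger=\psi$ and $\eta^\dagger\eta=\dim C(X)$. Let $\mathscr L(l^2(X))$ denote the space of linear operators on $l^2(X)$. For $A,B\in\mathscr L(l^2(X))$: $A^\dagger$ is the adjoint, $A^*(f):=(A(f^* ))^*$, the Schur product is $A\bullet B:=m(A\otimes B)m^\dagger$, $I$ is the identity, $J:=\eta\eta^\dagger$. A quantum coherent algebra over $X$ is a vector subspace of $\mathscr L(l^2(X))$ containing $I$ and $J$ and closed under composition, $\bullet$, $\dagger$ and $*$. A quantum graph on $X$ is given by an adjacency matrix $A\in\mathscr L(l^2(X))$ with $A\bullet A=A=A^*$; it is simple if $A=A^\dagger$ and $A\bullet I=0=I\bullet A$. It is distance regular with diameter $d$ if $\mathrm{span}\{I,A,A^2,\dots,A^d\}$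 is a $(d+1)$-dimensional quantum coherent algebra. Intersection array: for a simple distance regular quantum graph $A$ of diameter $d$ whose coherent algebra is commutative under $\bullet$, let $A_0=I$, $A_1=A$, and $A_i=\frac1{\beta_i}B_i$ with $B_i=A^i-\sum_{j=0}^{i-1}A^i\bullet A_j$, $\beta_i=\frac{\eta^\dagger(B_i\bullet B_i)\eta}{\eta^\dagger B_i\eta}$. The intersection array is $(b_0,\dots,b_{d-1};c_1,\dots,c_d)$, where these numbers together with numbers $a_0,\dots,a_d$ satisfy $AA_i=c_{i+1}A_{i+1}+a_iA_i+b_{i-1}A_{i-1}$ for $i=0,\dots,d$, with the convention $c_{d+1}A_{d+1}=0=b_{-1}A_{-1}$. A quantum Hadamard matrix on $X$ (with $N=\eta^\dagger\eta$) is a linear map $H\colon l^2(X)\to l^2(X)$ with $H=H^*$, $H\bullet H=\eta\eta^\dagger=J$, $HH^\dagger=N\,\mathrm{id}=H^\dagger H$. Put $H^\pm=\frac12(J\pm H)$. The associated quantum Hadamard graph lives on the quantum space $Y$ with $C(Y)=C(X)\oplus C(X)\oplus C(X)\oplus C(X)$ (functional the sum of the functionals on the summands) and has adjacency matrix $$A=\begin{pmatrix}0&0&H^+&H^-\\0&0&H^-&H^+\\(H^+)^\dagger&(H^-)^\dagger&0&0\\(H^-)^\dagger&(H^+)^\dagger&0&0\end{pmatrix}.$$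
   Formalization: The hypothesis N ≠ 1 is added (and C(X) is nonzero): for the one-point space with H = ±1 the associated graph satisfies A² = I, so span{I, A, ..., A⁴} has dimension 2 and the claim of diameter four fails. *)

(* Defs.v *)
From HB Require Import structures.
From mathcomp Require Import all_boot all_order all_algebra all_field.
From mathcomp Require Import ring boolp classical_sets.

Set Implicit Arguments.
Unset Strict Implicit.
Unset Printing Implicit Defensive.

Import Order.TTheory GRing.Theory Num.Theory.
Local Open Scope ring_scope.

HB.instance Definition _ (K : fieldType) (A B : falgType K) :=
  Vector.on (A * B)%type.

Section Forms.
Variable C : numClosedFieldType.
Implicit Types U V W : vectType C.

(* Sesquilinear forms are antilinear in the first argument. *)
Record nondeg_hermitian V (d : V -> V -> C) : Prop := NondegHermitian {
  herm_linear : forall u c v w, d u (c *: v + w) = c * d u v + d u w;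
  herm_conj : forall u v, d v u = (d u v)^*;
  herm_nondeg : forall u, (forall v, d u v = 0) -> u = 0 }.

(* The adjoint of f for the forms dU and dW; the default value 0 is never used *)
(* when dU and dW are nondegenerate (adjointP, adjoint_uniq). *)
Definition adjoint U W (dU : U -> U -> C) (dW : W -> W -> C) (f : 'Hom(U, W)) :
    'Hom(W, U) :=
  xget 0 [set g : 'Hom(W, U) | forall u w, dW (f u) w = dU u (g w)].

Section FormTheory.
Variables (V : vectType C) (d : V -> V -> C).
Hypothesis dP : nondeg_hermitian d.

Lemma herm0r u : d u 0 = 0.
Proof.
have := herm_linear dP u (-1) 0 0.
by rewrite scaler0 addr0 mulN1r addNr.
Qed.

Lemma hermDr u v w : d u (v + w) = d u v + d u w.
Proof. by have := herm_linear dP u 1 v w; rewrite scale1r mul1r. Qed.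

Lemma hermZr u c v : d u (c *: v) = c * d u v.
Proof. by have := herm_linear dP u c v 0; rewrite addr0 herm0r addr0. Qed.

Lemma herm_sumr u I (r : seq I) (F : I -> V) :
  d u (\sum_(i <- r) F i) = \sum_(i <- r) d u (F i).
Proof.
by elim/big_rec2: _ => [|i y x _ <-]; [exact: herm0r | rewrite hermDr].
Qed.

Lemma hermDl u v w : d (v + w) u = d v u + d w u.
Proof.
by rewrite !(herm_conj dP u) hermDr rmorphD.
Qed.

Lemma hermZl u c v : d (c *: v) u = c^* * d v u.
Proof. by rewrite !(herm_conj dP u) hermZr rmorphM. Qed.

Lemma herm_suml u I (r : seq I) (F : I -> V) :
  d (\sum_(i <- r) F i) u = \sum_(i <- r) d (F i) u.
Proof.
rewrite (herm_conj dP u) herm_sumr rmorph_sum.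
by apply: eq_bigr => i _; rewrite [RHS](herm_conj dP u).
Qed.

Lemma herm_inj v w : (forall u, d u v = d u w) -> v = w.
Proof.
move=> E; apply/eqP; rewrite -subr_eq0; apply/eqP/(herm_nondeg dP) => u.
rewrite (herm_conj dP) hermDr -scaleN1r hermZr E mulN1r subrr; exact: rmorph0.
Qed.

Lemma herm_basis u v : (forall i, d (vbasis {:V})`_i u = d (vbasis {:V})`_i v)
  -> forall w, d w u = d w v.
Proof.
move=> E w; rewrite (coord_vbasis (memvf w)) !herm_suml.
by apply: eq_bigr => i _; rewrite !hermZl E.
Qed.

End FormTheory.

Section AdjointTheory.
Variables (U W : vectType C) (dU : U -> U -> C) (dW : W -> W -> C).
Hypotheses (dUP : nondeg_hermitian dU) (dWP : nondeg_hermitian dW).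

Fact adjoint_exists (f : 'Hom(U, W)) :
  exists g : 'Hom(W, U), forall u w, dW (f u) w = dU u (g w).
Proof.
set e := vbasis {:U}.
pose p (v : U) := \row_(i < \dim {:U}) dU e`_i v.
have p_lin : linear p.
  by move=> c u v; apply/rowP => i; rewrite !mxE (herm_linear dUP).
pose q (w : W) := \row_(i < \dim {:U}) dW (f e`_i) w.
have q_lin : linear q.
  by move=> c u v; apply/rowP => i; rewrite !mxE (herm_linear dWP).
pose pL := GRing.isLinear.Build C U _ _ p p_lin.
pose P : {linear U -> 'rV[C]_(\dim {:U})} := HB.pack p pL.
pose qL := GRing.isLinear.Build C W _ _ q q_lin.
pose Q : {linear W -> 'rV[C]_(\dim {:U})} := HB.pack q qL.
have ker0 : lker (linfun P) == 0%VS.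
  apply/lker0P => u v; rewrite !lfunE /= => /rowP E.
  apply: (herm_inj dUP) => x; apply: (herm_basis dUP) => i.
  case: (ltnP i (\dim {:U})) => [lti|gei].
    by have := E (Ordinal lti); rewrite !mxE.
  rewrite nth_default ?size_tuple // (herm_conj dUP) (herm0r dUP).
  by rewrite [RHS](herm_conj dUP) (herm0r dUP).
have img : limg (linfun P) = fullv.
  apply/eqP; rewrite eqEdim subvf /= limg_dim_eq.
    by rewrite [X in (X <= _)%N]dimvf -[X in (_ <= X)%N]mul1n.
  by move/eqP: ker0 => /= ->; rewrite capv0.
exists ((linfun P)^-1 \o linfun Q)%VF => u w.
rewrite comp_lfunE.
have := @limg_lfunVK _ _ _ (linfun P) (linfun Q w); rewrite img memvf => /(_ isT).
rewrite ![linfun P _]lfunE ![linfun Q _]lfunE /=.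
set y := (_^-1)%VF _ => /rowP E.
rewrite (coord_vbasis (memvf u)) linear_sum (herm_suml dWP) (herm_suml dUP).
apply: eq_bigr => i _; rewrite linearZ /= (hermZl dWP) (hermZl dUP).
by have := E i; rewrite !mxE => ->.
Qed.

Lemma adjointP (f : 'Hom(U, W)) u w : dW (f u) w = dU u (adjoint dU dW f w).
Proof.
rewrite /adjoint; case: xgetP => [g _ /(_ u w) //|].
by case: (adjoint_exists f) => g gP /(_ g) /(_ gP).
Qed.

Lemma adjoint_uniq (f : 'Hom(U, W)) (g : 'Hom(W, U)) :
  (forall u w, dW (f u) w = dU u (g w)) -> adjoint dU dW f = g.
Proof.
move=> gP; apply/lfunP => w; apply: (herm_inj dUP) => u.
by rewrite -adjointP gP.
Qed.

End AdjointTheory.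

Lemma linfunE U V (f : U -> V) : linear f -> linfun f =1 f.
Proof.
move=> f_lin; pose fL := GRing.isLinear.Build C U V _ f f_lin.
pose F : {linear U -> V} := HB.pack f fL.
exact: (lfunE F).
Qed.

End Forms.


Section Tensor.
Variable C : numClosedFieldType.
Implicit Types U V W : vectType C.

(* The tensor product V (x) W in coordinates: the matrix T stands for *)
(* \sum_(i, j) T i j e_i (x) f_j, with e and f the bases vbasis of V and W. *)
Definition tensor V W : Type := 'M[C]_(\dim {:V}, \dim {:W}).
HB.instance Definition _ V W := Vector.on (tensor V W).

Definition tens V W (v : V) (w : W) : tensor V W :=
  \matrix_(i, j) (coord (vbasis {:V}) i v * coord (vbasis {:W}) j w).

(* The linear map with v (x) w |-> f v w, for f bilinear (bilin_extE). *)
Definition bilin_ext U V W (f : V -> W -> U) (T : tensor V W) : U :=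
  \sum_i \sum_j T i j *: f (vbasis {:V})`_i (vbasis {:W})`_j.

Definition tens_map V V' W W' (f : 'Hom(V, V')) (g : 'Hom(W, W')) :
    'Hom(tensor V W, tensor V' W') :=
  linfun (bilin_ext (fun v w => tens (f v) (g w))).

Definition tens_mul (A : falgType C) : 'Hom(tensor A A, A) :=
  linfun (bilin_ext (fun a b => a * b)).

(* The form with <v (x) w, v' (x) w'> = dV v v' * dW w w' (tens_dotE). *)
Definition tens_dot V W (dV : V -> V -> C) (dW : W -> W -> C)
    (S T : tensor V W) : C :=
  \sum_i \sum_j \sum_k \sum_l (S i j)^* * T k l *
    (dV (vbasis {:V})`_i (vbasis {:V})`_k * dW (vbasis {:W})`_j (vbasis {:W})`_l).

Lemma bilin_ext_linear U V W (f : V -> W -> U) : linear (bilin_ext f).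
Proof.
move=> c S T; rewrite /bilin_ext scaler_sumr -big_split; apply: eq_bigr => i _.
rewrite scaler_sumr -big_split; apply: eq_bigr => j _ /=.
by rewrite !mxE scalerDl scalerA.
Qed.

HB.instance Definition _ U V W (f : V -> W -> U) :=
  GRing.isLinear.Build C (tensor V W) U _ (bilin_ext f) (bilin_ext_linear f).

Lemma linear_sumZ U V (f : V -> U) n (c : 'I_n -> C) (x : 'I_n -> V) :
  linear f -> f (\sum_i c i *: x i) = \sum_i c i *: f (x i).
Proof.
move=> fL; elim/big_rec2: _ => [|i y z _ <-]; last exact: fL.
have := fL (-1) 0 0; rewrite scaler0 addr0 => ->.
by rewrite scaleN1r addNr.
Qed.

Lemma bilin_extE U V W (f : V -> W -> U) v w :
  (forall v, linear (f v)) -> (forall w, linear (f^~ w)) ->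
  bilin_ext f (tens v w) = f v w.
Proof.
move=> fr fl.
rewrite [in RHS](coord_vbasis (memvf v)) [in RHS](coord_vbasis (memvf w)).
rewrite (linear_sumZ _ _ (fl _)); apply: eq_bigr => i _.
rewrite (linear_sumZ _ _ (fr _)) scaler_sumr; apply: eq_bigr => j _.
by rewrite mxE scalerA.
Qed.

Lemma tens_linearr V W (v : V) : linear (@tens V W v).
Proof.
by move=> c w w'; apply/matrixP => i j; rewrite !mxE linearP mulrDr mulrCA.
Qed.

Lemma tens_linearl V W (w : W) : linear ((@tens V W)^~ w).
Proof.
by move=> c v v'; apply/matrixP => i j; rewrite !mxE linearP mulrDl mulrA.
Qed.

Lemma tens_mapE V V' W W' (f : 'Hom(V, V')) (g : 'Hom(W, W')) v w :
  tens_map f g (tens v w) = tens (f v) (g w).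
Proof.
rewrite lfunE; apply: (@bilin_extE _ _ _ (fun v w => tens (f v) (g w))).
  by move=> {}v c x y /=; rewrite linearP tens_linearr.
by move=> {}w c x y /=; rewrite linearP tens_linearl.
Qed.

Lemma tens_mulE (A : falgType C) (a b : A) : tens_mul A (tens a b) = a * b.
Proof.
rewrite lfunE; apply: (@bilin_extE _ _ _ (fun a b => a * b)) => x c y z.
  by rewrite mulrDr scalerAr.
by rewrite mulrDl scalerAl.
Qed.

Lemma tens_sum V W (T : tensor V W) :
  T = \sum_i \sum_j T i j *: tens (vbasis {:V})`_i (vbasis {:W})`_j.
Proof.
have fV := basis_free (vbasisP {:V}); have fW := basis_free (vbasisP {:W}).
apply/matrixP => i j; rewrite summxE (bigD1 i) //= summxE (bigD1 j) //=.
rewrite !mxE !coord_free // !eqxx !mulr1 !big1 ?addr0 // => [i' ne|j' ne].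
  rewrite summxE big1 // => j' _.
  by move: ne; rewrite !mxE !coord_free // -val_eqE => /negPf /= ->; rewrite mul0r mulr0.
by move: ne; rewrite !mxE !coord_free // -val_eqE => /negPf /= ->; rewrite !mulr0.
Qed.

Lemma tens_lin_ext U V W (f g : 'Hom(tensor V W, U)) :
  (forall v w, f (tens v w) = g (tens v w)) -> f = g.
Proof.
move=> E; apply/lfunP => T; rewrite (tens_sum T) !linear_sum.
apply: eq_bigr => i _; rewrite !linear_sum; apply: eq_bigr => j _.
by rewrite !linearZ /= E.
Qed.

Section Dot.
Variables (V W : vectType C) (dV : V -> V -> C) (dW : W -> W -> C).
Hypotheses (dVP : nondeg_hermitian dV) (dWP : nondeg_hermitian dW).
Local Notation dot := (tens_dot dV dW).

Lemma tens_dotE v w v' w' : dot (tens v w) (tens v' w') = dV v v' * dW w w'.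
Proof.
rewrite [in RHS](coord_vbasis (memvf v)) [in RHS](coord_vbasis (memvf w)).
rewrite (herm_suml dVP) (herm_suml dWP) mulr_suml; apply: eq_bigr => i _.
rewrite mulr_sumr; apply: eq_bigr => j _.
rewrite [in RHS](coord_vbasis (memvf v')) [in RHS](coord_vbasis (memvf w')).
rewrite (herm_sumr dVP) (herm_sumr dWP) mulr_suml; apply: eq_bigr => k _.
rewrite mulr_sumr; apply: eq_bigr => l _.
rewrite !mxE (hermZl dVP) (hermZl dWP) (hermZr dVP) (hermZr dWP) rmorphM /=.
ring.
Qed.

Lemma tens_dot_linear u c v w : dot u (c *: v + w) = c * dot u v + dot u w.
Proof.
rewrite /tens_dot mulr_sumr -big_split; apply: eq_bigr => i _.
rewrite mulr_sumr -big_split; apply: eq_bigr => j _.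
rewrite mulr_sumr -big_split; apply: eq_bigr => k _.
rewrite mulr_sumr -big_split; apply: eq_bigr => l _ /=.
by rewrite !mxE; ring.
Qed.

Lemma tens_dot_conj u v : dot v u = (dot u v)^*.
Proof.
rewrite /tens_dot rmorph_sum.
under [RHS]eq_bigr => i _.
  rewrite rmorph_sum; under eq_bigr => j _.
    rewrite rmorph_sum; under eq_bigr => k _.
      rewrite rmorph_sum; under eq_bigr => l _.
        rewrite !rmorphM /= conjCK -(herm_conj dVP) -(herm_conj dWP) [_ * (v k l)^*]mulrC.
      over.
    over.
  over.
over.
rewrite /=.
under [RHS]eq_bigr => i _ do rewrite exchange_big /=.
rewrite [RHS]exchange_big /=; apply: eq_bigr => k _.
under [RHS]eq_bigr => i _ do rewrite exchange_big /=.
rewrite [RHS]exchange_big /=; apply: eq_bigr => l _.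
by [].
Qed.

Lemma tens_dotTE T v w : dot T (tens v w) =
  \sum_i \sum_j (T i j)^* * (dV (vbasis {:V})`_i v * dW (vbasis {:W})`_j w).
Proof.
apply: eq_bigr => i _; apply: eq_bigr => j _.
rewrite [in RHS](coord_vbasis (memvf v)) [in RHS](coord_vbasis (memvf w)).
rewrite (herm_sumr dVP) (herm_sumr dWP) mulr_suml mulr_sumr.
apply: eq_bigr => k _; rewrite !mulr_sumr; apply: eq_bigr => l _.
by rewrite !mxE (hermZr dVP) (hermZr dWP); ring.
Qed.

Lemma tens_dot_nondeg T : (forall S, dot T S = 0) -> T = 0.
Proof.
move=> T0.
have /freeP fV := basis_free (vbasisP {:V}).
have /freeP fW := basis_free (vbasisP {:W}).
apply/matrixP => i j; rewrite mxE.
suff Ti0 : \sum_j T i j *: (vbasis {:W})`_j = 0 by exact: (fW (T i) Ti0).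
apply: (herm_nondeg dWP) => w.
pose k i := \sum_j T i j * (dW (vbasis {:W})`_j w)^*.
suff k0 : \sum_i k i *: (vbasis {:V})`_i = 0.
  have /(congr1 Num.conj) := fV k k0 i.
  rewrite rmorph0 rmorph_sum => <-; rewrite (herm_suml dWP).
  by apply: eq_bigr => j' _; rewrite (hermZl dWP) rmorphM /= conjCK.
apply: (herm_nondeg dVP) => v; rewrite -[RHS](T0 (tens v w)) tens_dotTE.
rewrite (herm_suml dVP); apply: eq_bigr => i' _.
rewrite (hermZl dVP) rmorph_sum mulr_suml; apply: eq_bigr => j' _.
by rewrite rmorphM /= conjCK; ring.
Qed.

Lemma tens_dot_hermitian : nondeg_hermitian dot.
Proof.
split; [exact: tens_dot_linear | exact: tens_dot_conj | exact: tens_dot_nondeg].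
Qed.

End Dot.
End Tensor.

Section QuantumSpace.
Variable C : numClosedFieldType.

Record star_algebra := StarAlgebra {
  star_alg :> falgType C;
  star : star_alg -> star_alg;
  starK : involutive star;
  starD : {morph star : a b / a + b};
  starZ : forall c a, star (c *: a) = c^* *: star a;
  starM : forall a b, star (a * b) = star b * star a }.

Definition dot (A : star_algebra) (psi : A -> C) (a b : A) : C :=
  psi (star a * b).

Record quantum_space := QuantumSpace {
  qspace :> star_algebra;
  psi : {scalar qspace};
  psi_ge0 : forall a, 0 <= psi (star a * a);
  psi_nondeg : forall a, (forall b, psi (a * b) = 0) -> a = 0;
  psiC : forall a b, psi (a * b) = psi (b * a);
  psi_special : (tens_mul qspace \o
    adjoint (tens_dot (dot psi) (dot psi)) (dot psi) (tens_mul qspace) = \1)%VF }.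

Lemma star1 (A : star_algebra) : star (1 : A) = 1.
Proof. by have := starM 1 (star (1 : A)); rewrite mul1r starK mul1r. Qed.

Lemma star0 (A : star_algebra) : star (0 : A) = 0.
Proof. by apply: (addrI (star 0)); rewrite -starD !addr0. Qed.

(* psi is Hermitian, from positivity by polarization. *)
Lemma psi_star_of (A : star_algebra) (psi : {scalar A}) :
  (forall a, 0 <= psi (star a * a)) -> forall a, psi (star a) = (psi a)^*.
Proof.
move=> ge0.
have psiR a : (psi (star a * a))^* = psi (star a * a).
  by apply/CrealP; rewrite ger0_real.
have sum_real b : psi (star b) + psi b = (psi (star b) + psi b)^*.
  have := psiR (1 + b); have := psiR b; have := psiR 1.
  rewrite starD star1 mulrDl !mulrDr !mulr1 !mul1r !linearD !rmorphD /=.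
  move=> -> -> E; apply: (addrI (psi 1)); apply: (addIr (psi (star b * b))).
  by move: E; rewrite -!addrA [psi b + _]addrCA => <-; rewrite [_^* + (_ + _)]addrCA.
move=> a; have := sum_real a; have := sum_real ('i *: a).
rewrite starZ !linearZ /= !rmorphD !rmorphM /= conjCK conjCi => E1 E2.
set x := psi a in E1 E2 *; set y := psi (star a) in E1 E2 *.
have E3 : x - y = y^* - x^*.
  apply: (mulfI (neq0Ci C)); rewrite !mulrBr -[LHS]addrC -mulNr E1.
  by rewrite mulNr.
have n2 : (2 : C) != 0 by rewrite pnatr_eq0.
apply: (mulfI n2).
have -> : 2 * y = (y + x) - (x - y) by ring.
by rewrite E2 E3; ring.
Qed.

Definition sp (X : quantum_space) : X -> X -> C := dot (@psi X).

Lemma dot_hermitian (A : star_algebra) (psi : {scalar A}) :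
  (forall a, 0 <= psi (star a * a)) ->
  (forall a, (forall b, psi (a * b) = 0) -> a = 0) ->
  nondeg_hermitian (dot psi).
Proof.
move=> ge0 nd; split=> [u c v w | u v | u u0].
- by rewrite /dot mulrDr -scalerAr linearP.
- by rewrite /dot -(psi_star_of ge0) starM starK.
- by rewrite -[u]starK (nd _ u0) star0.
Qed.

Lemma sp_hermitian (X : quantum_space) : nondeg_hermitian (@sp X).
Proof. exact: dot_hermitian (@psi_ge0 X) (@psi_nondeg X). Qed.

Section DirectSum.
Variables X Y : quantum_space.

Definition sum_star (x : X * Y) : X * Y := (star x.1, star x.2).

Fact sum_starK : involutive sum_star.
Proof. by case=> x y; rewrite /sum_star /= !starK. Qed.

Fact sum_starD : {morph sum_star : a b / a + b}.
Proof. by move=> a b; rewrite /sum_star /= !starD. Qed.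

Fact sum_starZ c a : sum_star (c *: a) = c^* *: sum_star a.
Proof. by rewrite /sum_star /= !starZ. Qed.

Fact sum_starM a b : sum_star (a * b) = sum_star b * sum_star a.
Proof. by rewrite /sum_star /= !starM. Qed.

Definition sum_star_algebra : star_algebra :=
  StarAlgebra sum_starK sum_starD sum_starZ sum_starM.

Definition sum_psi (x : sum_star_algebra) : C := psi X x.1 + psi Y x.2.

Fact sum_psi_linear : scalar sum_psi.
Proof. by move=> c x y; rewrite /sum_psi /= !linearP mulrDr addrACA. Qed.

HB.instance Definition _ :=
  GRing.isLinear.Build C sum_star_algebra C _ sum_psi sum_psi_linear.

Fact sum_psi_ge0 a : 0 <= sum_psi (star a * a).
Proof. by rewrite addr_ge0 // psi_ge0. Qed.

Fact sum_psi_nondeg a : (forall b, sum_psi (a * b) = 0) -> a = 0.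
Proof.
case: a => x y xy0; congr (_, _); apply: psi_nondeg => z.
  by have := xy0 (z, 0); rewrite /sum_psi /= mulr0 linear0 addr0.
by have := xy0 (0, z); rewrite /sum_psi /= mulr0 linear0 add0r.
Qed.

Fact sum_psiC a b : sum_psi (a * b) = sum_psi (b * a).
Proof. by rewrite /sum_psi /= psiC [psi Y _]psiC. Qed.

Let inX : 'Hom(X, sum_star_algebra) := linfun (fun x : X => (x, 0 : Y)).
Let inY : 'Hom(Y, sum_star_algebra) := linfun (fun y : Y => (0 : X, y)).
Let prX : 'Hom(sum_star_algebra, X) := linfun (fun z : X * Y => z.1).
Let prY : 'Hom(sum_star_algebra, Y) := linfun (fun z : X * Y => z.2).

Let inXE x : inX x = (x, 0).
Proof.
apply: (@linfunE _ _ sum_star_algebra (fun x : X => (x, 0 : Y))) => c u v.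
by congr (_, _); rewrite /= scaler0 addr0.
Qed.

Let inYE y : inY y = (0, y).
Proof.
apply: (@linfunE _ _ sum_star_algebra (fun y : Y => (0 : X, y))) => c u v.
by congr (_, _); rewrite /= scaler0 addr0.
Qed.

Let prXE z : prX z = z.1.
Proof. by apply: (@linfunE _ sum_star_algebra X (fun z : X * Y => z.1)). Qed.

Let prYE z : prY z = z.2.
Proof. by apply: (@linfunE _ sum_star_algebra Y (fun z : X * Y => z.2)). Qed.

Local Notation comul A d := (adjoint (tens_dot d d) d (tens_mul A)).

Fact sum_psi_special :
  (tens_mul sum_star_algebra \o comul sum_star_algebra (dot sum_psi) = \1)%VF.
Proof.
have dP : nondeg_hermitian (dot sum_psi).
  exact: dot_hermitian sum_psi_ge0 sum_psi_nondeg.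
have dX := sp_hermitian X; have dY := sp_hermitian Y.
pose D := (tens_map inX inX \o (comul X (@sp X) \o prX))%VF
  + (tens_map inY inY \o (comul Y (@sp Y) \o prY))%VF.
have DP T y : dot sum_psi (tens_mul _ T) y =
    tens_dot (dot sum_psi) (dot sum_psi) T (D y).
  have tP := tens_dot_hermitian dP dP.
  rewrite (tens_sum T) linear_sum (herm_suml dP) (herm_suml tP).
  apply: eq_bigr => i _; rewrite linear_sum (herm_suml dP) (herm_suml tP).
  apply: eq_bigr => j _; rewrite linearZ /= (hermZl dP) (hermZl tP).
  congr (_ * _).
  move: (_`_i) (_`_j) => a b; rewrite tens_mulE.
  rewrite add_lfunE !comp_lfunE (hermDr tP) prXE prYE.
  have EX t : tens_dot (dot sum_psi) (dot sum_psi) (tens a b) (tens_map inX inX t)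
      = tens_dot (@sp X) (@sp X) (tens a.1 b.1) t.
    rewrite (tens_sum t) linear_sum (herm_sumr tP).
    rewrite (herm_sumr (tens_dot_hermitian dX dX)); apply: eq_bigr => k _.
    rewrite linear_sum (herm_sumr tP).
    rewrite (herm_sumr (tens_dot_hermitian dX dX)); apply: eq_bigr => l _.
    rewrite linearZ /= (hermZr tP) (hermZr (tens_dot_hermitian dX dX)).
    rewrite tens_mapE (tens_dotE dP dP) (tens_dotE dX dX) !inXE.
    by rewrite /dot /sum_psi /= !mulr0 !linear0 !addr0.
  have EY t : tens_dot (dot sum_psi) (dot sum_psi) (tens a b) (tens_map inY inY t)
      = tens_dot (@sp Y) (@sp Y) (tens a.2 b.2) t.
    rewrite (tens_sum t) linear_sum (herm_sumr tP).
    rewrite (herm_sumr (tens_dot_hermitian dY dY)); apply: eq_bigr => k _.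
    rewrite linear_sum (herm_sumr tP).
    rewrite (herm_sumr (tens_dot_hermitian dY dY)); apply: eq_bigr => l _.
    rewrite linearZ /= (hermZr tP) (hermZr (tens_dot_hermitian dY dY)).
    rewrite tens_mapE (tens_dotE dP dP) (tens_dotE dY dY) !inYE.
    by rewrite /dot /sum_psi /= !mulr0 !linear0 !add0r.
  rewrite EX EY -(adjointP (tens_dot_hermitian dX dX) dX).
  by rewrite -(adjointP (tens_dot_hermitian dY dY) dY) !tens_mulE.
rewrite (adjoint_uniq (tens_dot_hermitian dP dP) dP DP).
have MX t : tens_mul sum_star_algebra (tens_map inX inX t) = inX (tens_mul X t).
  rewrite -!comp_lfunE; move: t; apply/lfunP; apply: tens_lin_ext => a b.
  rewrite !comp_lfunE tens_mapE !tens_mulE !inXE.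
  by congr (_, _); rewrite /= mulr0.
have MY t : tens_mul sum_star_algebra (tens_map inY inY t) = inY (tens_mul Y t).
  rewrite -!comp_lfunE; move: t; apply/lfunP; apply: tens_lin_ext => a b.
  rewrite !comp_lfunE tens_mapE !tens_mulE !inYE.
  by congr (_, _); rewrite /= mulr0.
apply/lfunP => z; rewrite comp_lfunE add_lfunE linearD /= !(comp_lfunE, MX, MY).
have := psi_special X => /lfunP/(_ z.1); rewrite comp_lfunE prXE => ->.
have := psi_special Y => /lfunP/(_ z.2); rewrite comp_lfunE prYE => ->.
rewrite !id_lfunE inXE inYE; case: z => x y.
by congr (_, _) => /=; rewrite ?addr0 ?add0r.
Qed.

Definition qsum : quantum_space :=
  QuantumSpace sum_psi_ge0 sum_psi_nondeg sum_psiC sum_psi_special.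

End DirectSum.

End QuantumSpace.

Section Operators.
Variables (C : numClosedFieldType) (X : quantum_space C).
Implicit Types (A B : 'End(X)) (S : {vspace 'End(X)}) (a b c : seq C).

Definition comul : 'Hom(X, tensor X X) :=
  adjoint (tens_dot (@sp C X) (@sp C X)) (@sp C X) (tens_mul X).

Definition schur A B : 'End(X) := (tens_mul X \o (tens_map A B \o comul))%VF.

Definition oadj A : 'End(X) := adjoint (@sp C X) (@sp C X) A.

Definition ostar A : 'End(X) := linfun (fun f => star (A (star f))).

(* eta^dagger = psi and eta = 1 (sp_unit), so J = eta eta^dagger maps f to *)
(* psi f *: 1, and eta^dagger B eta = psi (B 1). *)
Definition opJ : 'End(X) := linfun (fun f => psi X f *: (1 : X)).

Definition qdim : C := psi X 1.

Definition opow A n : 'End(X) := iter n (fun B => (A \o B)%VF) \1%VF.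

Definition power_span A d : {vspace 'End(X)} :=
  <<[seq opow A k | k <- iota 0 d.+1]>>%VS.

Record quantum_coherent S : Prop := QuantumCoherent {
  coherent_id : \1%VF \in S;
  coherent_J : opJ \in S;
  coherent_comp : forall A B, A \in S -> B \in S -> (A \o B)%VF \in S;
  coherent_schur : forall A B, A \in S -> B \in S -> schur A B \in S;
  coherent_adj : forall A, A \in S -> oadj A \in S;
  coherent_star : forall A, A \in S -> ostar A \in S }.

Definition quantum_graph A : Prop := schur A A = A /\ ostar A = A.

Definition simple_quantum_graph A : Prop :=
  [/\ quantum_graph A, oadj A = A, schur A \1%VF = 0 & schur \1%VF A = 0].

Definition distance_regular A d : Prop :=
  [/\ quantum_graph A, \dim (power_span A d) = d.+1
    & quantum_coherent (power_span A d)].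

(* B_i, given the list s of A_0, ..., A_(i-1). *)
Definition distance_num A s i : 'End(X) :=
  opow A i - \sum_(D <- s) schur (opow A i) D.

Definition beta B : C := psi X (schur B B 1) / psi X (B 1).

(* The list of A_0, ..., A_(n-1). *)
Fixpoint distance_ops A n : seq 'End(X) :=
  if n is i.+1 then
    let s := distance_ops A i in
    rcons s (match i with
             | 0 => \1%VF
             | 1 => A
             | _ => let B := distance_num A s i in (beta B)^-1 *: B
             end)
  else [::].

Definition distance_op A i : 'End(X) := nth 0 (distance_ops A i.+1) i.

(* (b_0, ..., b_(d-1); c_1, ..., c_d) is the intersection array of A. Lists *)
(* are indexed from 0, so nth 0 c i is c_(i+1). The field array_beta states *)
(* that numerator and denominator of every beta_i are nonzero. *)
Record intersection_array A d b c : Prop := IntersectionArray {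
  array_simple : simple_quantum_graph A;
  array_distance_regular : distance_regular A d;
  array_schurC : {in power_span A d &, commutative schur};
  array_beta : forall i, (0 < i <= d)%N ->
    let B := distance_num A (distance_ops A i) i in
    psi X (B 1) != 0 /\ psi X (schur B B 1) != 0;
  array_sizeb : size b = d;
  array_sizec : size c = d;
  array_eq : exists a, size a = d.+1 /\ forall i, (i <= d)%N ->
    (A \o distance_op A i)%VF =
      (if (i < d)%N then c`_i *: distance_op A i.+1 else 0)
      + a`_i *: distance_op A i
      + (if (0 < i)%N then b`_i.-1 *: distance_op A i.-1 else 0) }.

Record quantum_hadamard (H : 'End(X)) : Prop := QuantumHadamard {
  hadamard_star : ostar H = H;
  hadamard_schur : schur H H = opJ;
  hadamard_mulr : (H \o oadj H)%VF = qdim *: \1%VF;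
  hadamard_mull : (oadj H \o H)%VF = qdim *: \1%VF }.

Lemma oadjP A f g : sp (A f) g = sp f (oadj A g).
Proof. exact: adjointP (sp_hermitian X) (sp_hermitian X) A f g. Qed.

Lemma comulP (T : tensor X X) f :
  sp (tens_mul X T) f = tens_dot (@sp C X) (@sp C X) T (comul f).
Proof.
have h := sp_hermitian X.
exact: adjointP (tens_dot_hermitian h h) h (tens_mul X) T f.
Qed.

Lemma ostarE A f : ostar A f = star (A (star f)).
Proof.
apply: linfunE => c u v.
by rewrite starD starZ linearP starD starZ conjCK.
Qed.

Lemma opJE f : opJ f = psi X f *: 1.
Proof. by apply: linfunE => c u v; rewrite linearP scalerDl scalerA. Qed.

Lemma sp_unit (c : C) (f : X) : sp (c *: 1) f = c^* * psi X f.
Proof. by rewrite /sp /dot starZ star1 -scalerAl mul1r linearZ. Qed.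

End Operators.

Section HadamardGraph.
Variables (C : numClosedFieldType) (X : quantum_space C).

(* The operator with block matrix (P, Q; R, S). *)
Definition block_op (Y Z : quantum_space C) (P : 'Hom(Y, Y)) (Q : 'Hom(Z, Y))
    (R : 'Hom(Y, Z)) (S : 'Hom(Z, Z)) : 'End(qsum Y Z) :=
  linfun (fun u : Y * Z => (P u.1 + Q u.2, R u.1 + S u.2)).

Lemma block_opE (Y Z : quantum_space C) P Q R S (u : Y * Z) :
  @block_op Y Z P Q R S u = (P u.1 + Q u.2, R u.1 + S u.2).
Proof.
apply: (@linfunE _ (qsum Y Z) (qsum Y Z)
  (fun u : Y * Z => (P u.1 + Q u.2, R u.1 + S u.2))) => c x y.
by congr (_, _); rewrite /= !linearP addrACA -scalerDr.
Qed.

Definition hadamard_plus (H : 'End(X)) : 'End(X) := 2^-1 *: (opJ X + H).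
Definition hadamard_minus (H : 'End(X)) : 'End(X) := 2^-1 *: (opJ X - H).

Definition hadamard_space : quantum_space C := qsum (qsum X X) (qsum X X).

Definition hadamard_graph (H : 'End(X)) : 'End(hadamard_space) :=
  let P := hadamard_plus H in let M := hadamard_minus H in
  block_op 0 (block_op P M M P)
    (block_op (oadj P) (oadj M) (oadj M) (oadj P)) 0.

End HadamardGraph.

(* Main.v *)
Require Import Defs.
From mathcomp Require Import all_boot all_order all_algebra all_field.
From mathcomp Require Import reals complex.
From mathcomp Require Import ring.

(** The quantum Hadamard graph A behaves as the classical one: its coherent
    algebra is spanned by five quantum graphs, the distance classes
<<
      A_0 = I,  A_1 = A,  A_2 = E - I - S,  A_3,  A_4 = S.
>>
    Here E is J on each half (the first two and the last two summands of C(Y)),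
    S is the antipodal operator exchanging the two copies of X inside each half,
    and A_3 is A with H^+ and H^- exchanged, which is the Hadamard graph of - H.

    Two facts about X enter. The first is that J is the unit of the Schur product
    (schur_Jl, schur_Jr); with H . H = J it makes H^+ = (J + H) / 2 and
    H^- = (J - H) / 2 orthogonal Schur idempotents. The second is
    H H^dagger = H^dagger H = N, which gives
<<
      H^+ (H^+)^dagger + H^- (H^-)^dagger = N I + N/2 (J - I),
      H^+ (H^-)^dagger + H^- (H^+)^dagger = N/2 (J - I)
>>
    and the same identities with the adjoints on the left. Since Schur products,
    adjoints and stars of block operators are computed blockwise (schur_block,
    oadj_block, ostar_block), the classes A_i are self-adjoint orthogonal Schur
    idempotents with sum J, and multiplying by A gives
<<
      A A_0 = A_1,                      A A_1 = N/2 A_2 + N A_0,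
      A A_2 = (N-1) A_3 + (N-1) A_1,    A A_3 = N A_4 + N/2 A_2,
      A A_4 = A_3.
>>

    The rest is independent of Hadamard matrices. For any such system
    A_0, ..., A_d with a three-term recurrence, nonzero c_1, ..., c_d and nonzero
    psi(A_i 1), the power A^i is c_1 ... c_i A_i plus a combination of earlier classes
    (opow_lead). Hence the powers of A span the same space as the A_i, that space
    is a coherent algebra, and the Gram-Schmidt process that defines the distance
    operators of A returns the A_i (distance_opsE). The numbers psi(A_i 1) are
    4N, 4N^2, 4N(N-1), 4N^2 and 4N, so the normalisations beta_i make sense as
    soon as N is neither 0 nor 1, and N <> 0 always holds (qdim_neq0). *)

Set Implicit Arguments.
Unset Strict Implicit.
Unset Printing Implicit Defensive.

Import Order.TTheory GRing.Theory Num.Theory.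
Local Open Scope ring_scope.

(** * Spans *)

Section LinearSpan.
Variables (K : fieldType) (V : vectType K).

(** Induction over a span; linear maps are not enough here because the adjoint
    and the star are antilinear. *)
Lemma span_ind (P : V -> Prop) (s : seq V) :
  P 0 -> (forall c u v, P u -> P v -> P (c *: u + v)) ->
  (forall v, v \in s -> P v) -> forall v, v \in <<s>>%VS -> P v.
Proof.
move=> P0 PD Ps v /(coord_span (X := in_tuple s)) ->.
elim/big_rec: _ => // i w _ Pw; apply: PD => //.
by apply: Ps; rewrite mem_nth.
Qed.

End LinearSpan.

(** * Schur product, adjoint and star *)

Section SchurProduct.
Variables (C : numClosedFieldType).

(** (F (x) G)^dagger = F^dagger (x) G^dagger, in a form that needs only functions
    F' and G' satisfying the adjunction identity. *)
Lemma tens_dot_mapr (U U' V V' : vectType C) dU dU' dV dV' (F : 'Hom(U, V))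
    (G : 'Hom(U', V')) (F' : V -> U) (G' : V' -> U') v w t :
  nondeg_hermitian dU -> nondeg_hermitian dU' ->
  nondeg_hermitian dV -> nondeg_hermitian dV' ->
  (forall v u, dV v (F u) = dU (F' v) u) ->
  (forall v u, dV' v (G u) = dU' (G' v) u) ->
  tens_dot dV dV' (tens v w) (tens_map F G t)
    = tens_dot dU dU' (tens (F' v) (G' w)) t.
Proof.
move=> hU hU' hV hV' FF' GG'.
have h := tens_dot_hermitian hU hU'; have h' := tens_dot_hermitian hV hV'.
rewrite (tens_sum t) linear_sum (herm_sumr h') (herm_sumr h).
apply: eq_bigr => i _; rewrite linear_sum (herm_sumr h') (herm_sumr h).
apply: eq_bigr => j _; rewrite linearZ /= (hermZr h') (hermZr h) tens_mapE.
by rewrite (tens_dotE hV hV') (tens_dotE hU hU') FF' GG'.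
Qed.

Variable X : quantum_space C.
Implicit Types (A B D : 'End(X)) (f g : X).

Let spP := sp_hermitian X.
Let sp2P := tens_dot_hermitian spP spP.

Lemma comul_uniq f t :
  (forall a b, sp (a * b) f = tens_dot (@sp C X) (@sp C X) (tens a b) t) ->
  comul X f = t.
Proof.
move=> E; apply: (herm_inj sp2P) => T; rewrite -comulP.
rewrite (tens_sum T) linear_sum (herm_suml spP) (herm_suml sp2P).
apply: eq_bigr => i _; rewrite linear_sum (herm_suml spP) (herm_suml sp2P).
apply: eq_bigr => j _; rewrite linearZ /= (hermZl spP) (hermZl sp2P).
by rewrite tens_mulE E.
Qed.

Lemma schurE A B f : schur A B f = tens_mul X (tens_map A B (comul X f)).
Proof. by rewrite !comp_lfunE. Qed.

Lemma schur_linearl (c : C) A B D :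
  schur (c *: A + B) D = c *: schur A D + schur B D.
Proof.
have E : tens_map (c *: A + B) D = c *: tens_map A D + tens_map B D.
  apply: tens_lin_ext => a b.
  by rewrite add_lfunE scale_lfunE !tens_mapE add_lfunE scale_lfunE tens_linearl.
by apply/lfunP => f; rewrite add_lfunE scale_lfunE !schurE E add_lfunE scale_lfunE linearP.
Qed.

Lemma schur_linearr (c : C) A B D :
  schur D (c *: A + B) = c *: schur D A + schur D B.
Proof.
have E : tens_map D (c *: A + B) = c *: tens_map D A + tens_map D B.
  apply: tens_lin_ext => a b.
  by rewrite add_lfunE scale_lfunE !tens_mapE add_lfunE scale_lfunE tens_linearr.
by apply/lfunP => f; rewrite add_lfunE scale_lfunE !schurE E add_lfunE scale_lfunE linearP.
Qed.

Lemma schur0l A : schur 0 A = 0.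
Proof. by have := schur_linearl (-1) 0 0 A; rewrite scaler0 addr0 scaleN1r addNr. Qed.

Lemma schur0r A : schur A 0 = 0.
Proof. by have := schur_linearr (-1) 0 0 A; rewrite scaler0 addr0 scaleN1r addNr. Qed.

Lemma schurDl A B D : schur (A + B) D = schur A D + schur B D.
Proof. by have := schur_linearl 1 A B D; rewrite !scale1r. Qed.

Lemma schurDr A B D : schur D (A + B) = schur D A + schur D B.
Proof. by have := schur_linearr 1 A B D; rewrite !scale1r. Qed.

Lemma schurZl (c : C) A D : schur (c *: A) D = c *: schur A D.
Proof. by have := schur_linearl c A 0 D; rewrite !addr0 schur0l addr0. Qed.

Lemma schurZr (c : C) A D : schur D (c *: A) = c *: schur D A.
Proof. by have := schur_linearr c A 0 D; rewrite !addr0 schur0r addr0. Qed.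

Lemma schurBl A B D : schur (A - B) D = schur A D - schur B D.
Proof. by rewrite schurDl -scaleN1r schurZl scaleN1r. Qed.

Lemma schurBr A B D : schur D (A - B) = schur D A - schur D B.
Proof. by rewrite schurDr -scaleN1r schurZr scaleN1r. Qed.

Lemma sp1 f : sp 1 f = psi X f.
Proof. by rewrite -[1]scale1r sp_unit conjC1 mul1r. Qed.

(** If e is the adjoint of a linear section p of the multiplication m, then
    e m^dagger = (m p)^dagger = id. *)
Lemma comul_counit (e : 'Hom(tensor X X, X)) (p : X -> tensor X X) :
  (forall w, tens_mul X (p w) = w) ->
  (forall w a b,
    sp w (e (tens a b)) = tens_dot (@sp C X) (@sp C X) (p w) (tens a b)) ->
  forall f, e (comul X f) = f.
Proof.
move=> mp ep f; apply: (herm_inj spP) => w; rewrite -[in RHS](mp w) comulP.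
rewrite (tens_sum (comul X f)) linear_sum (herm_sumr spP) (herm_sumr sp2P).
apply: eq_bigr => i _; rewrite linear_sum (herm_sumr spP) (herm_sumr sp2P).
apply: eq_bigr => j _.
by rewrite linearZ /= (hermZr spP) (hermZr sp2P) ep.
Qed.

(** J is a unit for the Schur product because m (J (x) A) = A e, where the map
    e = psi (x) id is the adjoint of w |-> 1 (x) w, a section of m; the other
    side is symmetric. *)
Lemma schur_Jl A : schur (opJ X) A = A.
Proof.
pose e : 'Hom(tensor X X, X) := linfun (bilin_ext (fun a b => psi X a *: b)).
have eE a b : e (tens a b) = psi X a *: b.
  rewrite lfunE; apply: (@bilin_extE _ _ _ _ (fun a b => psi X a *: b) a b).
    by move=> v c x y; rewrite scalerDr !scalerA mulrC.
  by move=> v c x y; rewrite linearP scalerDl scalerA.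
have mJ : (tens_mul X \o tens_map (opJ X) A)%VF = (A \o e)%VF.
  apply: tens_lin_ext => a b; rewrite !comp_lfunE tens_mapE tens_mulE eE opJE.
  by rewrite -scalerAl mul1r linearZ.
apply/lfunP => f; rewrite schurE -comp_lfunE mJ comp_lfunE.
rewrite (comul_counit (p := tens 1)) // => [w|w a b].
  by rewrite tens_mulE mul1r.
by rewrite eE (hermZr spP) (tens_dotE spP spP) sp1.
Qed.

Lemma schur_Jr A : schur A (opJ X) = A.
Proof.
pose e : 'Hom(tensor X X, X) := linfun (bilin_ext (fun a b => psi X b *: a)).
have eE a b : e (tens a b) = psi X b *: a.
  rewrite lfunE; apply: (@bilin_extE _ _ _ _ (fun a b => psi X b *: a) a b).
    by move=> v c x y; rewrite linearP scalerDl scalerA.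
  by move=> v c x y; rewrite scalerDr !scalerA mulrC.
have mJ : (tens_mul X \o tens_map A (opJ X))%VF = (A \o e)%VF.
  apply: tens_lin_ext => a b; rewrite !comp_lfunE tens_mapE tens_mulE eE opJE.
  by rewrite -scalerAr mulr1 linearZ.
apply/lfunP => f; rewrite schurE -comp_lfunE mJ comp_lfunE.
rewrite (comul_counit (p := (@tens C X X)^~ 1)) // => [w|w a b].
  by rewrite tens_mulE mulr1.
by rewrite eE (hermZr spP) (tens_dotE spP spP) sp1 mulrC.
Qed.

(** This is the normalisation m m^dagger = id of psi. *)
Lemma schur_id : schur \1%VF \1%VF = \1%VF :> 'End(X).
Proof.
rewrite -[RHS]psi_special /schur; congr (_ \o _)%VF.
rewrite -[RHS]comp_lfun1l; congr (_ \o _)%VF.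
by apply: tens_lin_ext => a b; rewrite tens_mapE !id_lfunE.
Qed.

Lemma oadj_uniq A B : (forall f g, sp (A f) g = sp f (B g)) -> oadj A = B.
Proof. exact: (adjoint_uniq spP spP). Qed.

Lemma oadjK : involutive (@oadj C X).
Proof.
by move=> A; apply: oadj_uniq => f g; rewrite (herm_conj spP) -oadjP -(herm_conj spP).
Qed.

Lemma oadj_linear (c : C) A B : oadj (c *: A + B) = c^* *: oadj A + oadj B.
Proof.
apply: oadj_uniq => f g; rewrite !add_lfunE !scale_lfunE.
by rewrite (hermDl spP) (hermDr spP) (hermZl spP) (hermZr spP) !oadjP.
Qed.

Lemma oadj0 : oadj (0 : 'End(X)) = 0.
Proof. by have := oadj_linear (-1) 0 0; rewrite scaler0 addr0 rmorphN1 scaleN1r addNr. Qed.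

Lemma oadjD A B : oadj (A + B) = oadj A + oadj B.
Proof. by have := oadj_linear 1 A B; rewrite conjC1 !scale1r. Qed.

Lemma oadjZ (c : C) A : oadj (c *: A) = c^* *: oadj A.
Proof. by have := oadj_linear c A 0; rewrite oadj0 !addr0. Qed.

Lemma oadjB A B : oadj (A - B) = oadj A - oadj B.
Proof. by rewrite oadjD -scaleN1r oadjZ rmorphN1 scaleN1r. Qed.

Lemma oadj_id : oadj \1%VF = \1%VF :> 'End(X).
Proof. by apply: oadj_uniq => f g; rewrite !id_lfunE. Qed.

Lemma oadj_J : oadj (opJ X) = opJ X.
Proof.
apply: oadj_uniq => f g; rewrite !opJE sp_unit (hermZr spP).
by rewrite [sp f 1](herm_conj spP) sp1 mulrC.
Qed.

(** (m (A (x) B) m^dagger)^dagger = m (A^dagger (x) B^dagger) m^dagger. *)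
Lemma schur_adj A B : oadj (schur A B) = schur (oadj A) (oadj B).
Proof.
apply: oadj_uniq => f g; rewrite !schurE comulP.
rewrite [RHS](herm_conj spP) comulP -(herm_conj sp2P).
rewrite [in LHS](tens_sum (comul X f)) [in RHS](tens_sum (comul X f)).
rewrite linear_sum !(herm_suml sp2P); apply: eq_bigr => i _.
rewrite linear_sum !(herm_suml sp2P); apply: eq_bigr => j _.
rewrite linearZ /= !(hermZl sp2P) tens_mapE; congr (_ * _).
rewrite (tens_dot_mapr (F' := A) (G' := B) _ _ _ spP spP spP spP) //.
  by move=> v u; rewrite oadjP.
by move=> v u; rewrite oadjP.
Qed.

Lemma ostar_linear (c : C) A B : ostar (c *: A + B) = c^* *: ostar A + ostar B.
Proof.
apply/lfunP => f; rewrite add_lfunE scale_lfunE !ostarE add_lfunE scale_lfunE.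
by rewrite starD starZ.
Qed.

Lemma ostar0 : ostar (0 : 'End(X)) = 0.
Proof. by have := ostar_linear (-1) 0 0; rewrite scaler0 addr0 rmorphN1 scaleN1r addNr. Qed.

Lemma ostarD A B : ostar (A + B) = ostar A + ostar B.
Proof. by have := ostar_linear 1 A B; rewrite conjC1 !scale1r. Qed.

Lemma ostarZ (c : C) A : ostar (c *: A) = c^* *: ostar A.
Proof. by have := ostar_linear c A 0; rewrite ostar0 !addr0. Qed.

Lemma ostarB A B : ostar (A - B) = ostar A - ostar B.
Proof. by rewrite ostarD -scaleN1r ostarZ rmorphN1 scaleN1r. Qed.

Lemma ostar_id : ostar \1%VF = \1%VF :> 'End(X).
Proof. by apply/lfunP => f; rewrite ostarE !id_lfunE starK. Qed.

Lemma psi_star f : psi X (star f) = (psi X f)^*.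
Proof. exact: (psi_star_of (@psi_ge0 C X)). Qed.

Lemma ostar_J : ostar (opJ X) = opJ X.
Proof.
by apply/lfunP => f; rewrite ostarE !opJE starZ star1 psi_star conjCK.
Qed.

Lemma sp_star f g : sp (star f) (star g) = sp g f.
Proof. by rewrite /sp /dot starK psiC. Qed.

(** The star is an anti-isometry because psi is tracial, so it commutes with
    taking adjoints. *)
Lemma ostar_adj A : ostar (oadj A) = oadj (ostar A).
Proof.
apply/esym/oadj_uniq => f g.
rewrite !ostarE -[in LHS](starK g) -[in RHS](starK f) !sp_star.
by rewrite oadjP oadjK.
Qed.

Lemma opJ_comp : (opJ X \o opJ X)%VF = qdim X *: opJ X.
Proof.
apply/lfunP => f; rewrite comp_lfunE scale_lfunE !opJE linearZ /= scalerA.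
by rewrite mulrC.
Qed.

(** By Cauchy-Schwarz, psi 1 = 0 would make psi vanish identically, against
    nondegeneracy. *)
Lemma qdim_neq0 : qdim X != 0.
Proof.
apply/eqP => N0; have := oner_neq0 X; case/eqP.
apply: psi_nondeg => b; rewrite mul1r; set c := psi X b.
set q := psi X (star b * b); have q_ge0 : 0 <= q := psi_ge0 b.
have q1 : 0 < 1 + q by rewrite ltr_pwDl.
apply/eqP; apply/negPn/negP => c0.
have k0 : 0 < c * c^* by rewrite mul_conjC_gt0.
pose s := (1 + q)^-1; have s0 : 0 < s by rewrite invr_gt0.
have sR : s^* = s by apply/CrealP; rewrite gtr0_real.
(* The parameter - s c^* is close enough to the minimiser of the quadratic form
   to make it negative, and stays defined when q = 0. *)
have := psi_ge0 (1 + (- s * c^*) *: b).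
rewrite starD starZ star1 mulrDl !mulrDr !mulr1 mul1r !linearD /=.
rewrite -/(qdim X) N0 add0r -scalerAl -scalerAr !linearZ /= psi_star -/c -/q.
rewrite rmorphM rmorphN /= conjCK sR.
have -> : - s * c^* * c + (- s * c * c^* + - s * c * (- s * c^* * q))
    = - (s * (c * c^*) * (2 - s * q)) by ring.
rewrite oppr_ge0 => /(lt_le_trans _) le0.
have : 0 < s * (c * c^*) * (2 - s * q).
  apply: mulr_gt0; first exact: mulr_gt0.
  rewrite subr_gt0 /s mulrC ltr_pdivrMr // mulrDr mulr1.
  rewrite -subr_gt0; have -> : 2 + 2 * q - q = 2 + q by ring.
  by rewrite ltr_wpDr.
by move/le0; rewrite ltxx.
Qed.

End SchurProduct.

(** * Operators on a direct sum *)

Section BlockOperators.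
Variables (C : numClosedFieldType) (X : quantum_space C).
Implicit Types (P Q R S : 'End(X)).

Let XX := qsum X X.
Let spP := sp_hermitian X.
Let spPP := sp_hermitian XX.

Lemma sp_qsum (u v : XX) : sp u v = sp u.1 v.1 + sp u.2 v.2.
Proof. by []. Qed.

Lemma psi_qsum (u : XX) : psi XX u = psi X u.1 + psi X u.2.
Proof. by []. Qed.

Lemma comp_block P Q R S P' Q' R' S' :
  (block_op P Q R S \o block_op P' Q' R' S')%VF =
  block_op ((P \o P') + (Q \o R'))%VF ((P \o Q') + (Q \o S'))%VF
           ((R \o P') + (S \o R'))%VF ((R \o Q') + (S \o S'))%VF.
Proof.
apply/lfunP => u; rewrite comp_lfunE !block_opE /=.
by rewrite !add_lfunE !comp_lfunE !linearD /=; congr (_, _); rewrite addrACA.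
Qed.

Lemma add_block P Q R S P' Q' R' S' :
  block_op P Q R S + block_op P' Q' R' S' =
  block_op (P + P') (Q + Q') (R + R') (S + S').
Proof.
apply/lfunP => u; rewrite add_lfunE !block_opE /= !add_lfunE.
by congr (_, _); rewrite /= addrACA.
Qed.

Lemma scale_block (c : C) P Q R S :
  c *: block_op P Q R S = block_op (c *: P) (c *: Q) (c *: R) (c *: S).
Proof.
apply/lfunP => u; rewrite scale_lfunE !block_opE /= !scale_lfunE.
by congr (_, _); rewrite /= scalerDr.
Qed.

Lemma block_id : block_op \1%VF 0 0 \1%VF = \1%VF :> 'End(XX).
Proof.
by apply/lfunP => -[u v]; rewrite block_opE !id_lfunE !zero_lfunE /= addr0 add0r.
Qed.

Lemma block_J :
  block_op (opJ X) (opJ X) (opJ X) (opJ X) = opJ XX.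
Proof.
by apply/lfunP => u; rewrite block_opE !opJE psi_qsum -!scalerDl.
Qed.

Lemma psi_block P Q R S : psi XX (block_op P Q R S 1) =
  psi X (P 1) + psi X (Q 1) + (psi X (R 1) + psi X (S 1)).
Proof. by rewrite block_opE psi_qsum !linearD. Qed.

Lemma ostar_block P Q R S :
  ostar (block_op P Q R S) = block_op (ostar P) (ostar Q) (ostar R) (ostar S).
Proof.
apply/lfunP => u; rewrite ostarE !block_opE !ostarE /=.
by rewrite /star /= /sum_star /= !starD.
Qed.

Lemma oadj_block P Q R S :
  oadj (block_op P Q R S) = block_op (oadj P) (oadj R) (oadj Q) (oadj S).
Proof.
apply: oadj_uniq => u v; rewrite !block_opE !sp_qsum /=.
rewrite !(hermDl spP) !(hermDr spP) !oadjP; ring.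
Qed.

(** Multiplication and comultiplication of a direct sum preserve the summands, so
    the Schur product cannot mix different blocks. *)
Lemma schur_block P Q R S P' Q' R' S' :
  schur (block_op P Q R S) (block_op P' Q' R' S') =
  block_op (schur P P') (schur Q Q') (schur R R') (schur S S').
Proof.
pose in1 : 'Hom(X, XX) := linfun (fun x : X => (x, 0 : X)).
pose in2 : 'Hom(X, XX) := linfun (fun x : X => (0 : X, x)).
have in1E x : in1 x = (x, 0).
  apply: (@linfunE _ _ XX (fun x : X => (x, 0 : X))) => c u v.
  by congr (_, _); rewrite /= scaler0 addr0.
have in2E x : in2 x = (0, x).
  apply: (@linfunE _ _ XX (fun x : X => (0 : X, x))) => c u v.
  by congr (_, _); rewrite /= scaler0 addr0.
have in1P (u : XX) x : sp u (in1 x) = sp u.1 x.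
  by rewrite in1E sp_qsum /= (herm0r spP) addr0.
have in2P (u : XX) x : sp u (in2 x) = sp u.2 x.
  by rewrite in2E sp_qsum /= (herm0r spP) add0r.
have comulE (u : XX) : comul XX u =
    tens_map in1 in1 (comul X u.1) + tens_map in2 in2 (comul X u.2).
  apply: comul_uniq => a b; rewrite (hermDr (tens_dot_hermitian spPP spPP)).
  rewrite (tens_dot_mapr _ _ _ spP spP spPP spPP in1P in1P).
  rewrite (tens_dot_mapr _ _ _ spP spP spPP spPP in2P in2P).
  by rewrite -!comulP !tens_mulE.
pose m U V : 'Hom(tensor X X, X) := (tens_mul X \o tens_map U V)%VF.
have m1 : (tens_mul XX \o (tens_map (block_op P Q R S) (block_op P' Q' R' S')
    \o tens_map in1 in1) = (in1 \o m P P') + (in2 \o m R R'))%VF.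
  apply: tens_lin_ext => a b; rewrite add_lfunE !comp_lfunE !tens_mapE !tens_mulE.
  rewrite !in1E in2E !block_opE /= !linear0 !addr0.
  by congr (_, _); rewrite /= ?addr0 ?add0r.
have m2 : (tens_mul XX \o (tens_map (block_op P Q R S) (block_op P' Q' R' S')
    \o tens_map in2 in2) = (in1 \o m Q Q') + (in2 \o m S S'))%VF.
  apply: tens_lin_ext => a b; rewrite add_lfunE !comp_lfunE !tens_mapE !tens_mulE.
  rewrite !in2E in1E !block_opE /= !linear0 !add0r.
  by congr (_, _); rewrite /= ?addr0 ?add0r.
apply/lfunP => u; rewrite schurE comulE !linearD /= block_opE !schurE.
move/lfunP: m1 => /(_ (comul X u.1)); move/lfunP: m2 => /(_ (comul X u.2)).
rewrite !add_lfunE !comp_lfunE !in1E !in2E => -> ->.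
by congr (_, _); rewrite /= !(addr0, add0r).
Qed.

End BlockOperators.

(** * Distance classes from orthogonal Schur idempotents *)

Section SchurIdempotents.
Variables (C : numClosedFieldType) (Y : quantum_space C) (A : 'End(Y)) (d : nat).
Variables (D : nat -> 'End(Y)) (b c a : seq C).
Hypothesis d_gt0 : (0 < d)%N.
Hypothesis D0 : D 0 = \1%VF.
Hypothesis D1 : D 1 = A.
Hypothesis schur_idempotents : forall i j, (i <= d)%N -> (j <= d)%N ->
  schur (D i) (D j) = if i == j then D i else 0.
Hypothesis psi_idempotent : forall i, (i <= d)%N -> psi Y (D i 1) != 0.
Hypothesis sum_idempotents : \sum_(i < d.+1) D i = opJ Y.
Hypothesis oadj_idempotent : forall i, (i <= d)%N -> oadj (D i) = D i.
Hypothesis ostar_idempotent : forall i, (i <= d)%N -> ostar (D i) = D i.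
Hypotheses (size_b : size b = d) (size_c : size c = d) (size_a : size a = d.+1).
Hypothesis c_neq0 : forall i, (i < d)%N -> c`_i != 0.
Hypothesis three_term : forall i, (i <= d)%N ->
  (A \o D i)%VF = (if (i < d)%N then c`_i *: D i.+1 else 0)
    + a`_i *: D i + (if (0 < i)%N then b`_i.-1 *: D i.-1 else 0).

Local Notation spanD n := <<mkseq D n>>%VS.
Local Notation gamma n := (\prod_(k < n) c`_k).

Lemma mem_spanD n i : (i < n)%N -> D i \in spanD n.
Proof.
by move=> lt_in; apply: memv_span; apply/mapP; exists i; rewrite ?mem_iota.
Qed.

Lemma spanD_ind n (P : 'End(Y) -> Prop) :
  P 0 -> (forall x u v, P u -> P v -> P (x *: u + v)) ->
  (forall i, (i < n)%N -> P (D i)) -> forall v, v \in spanD n -> P v.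
Proof.
move=> P0 PD PDi; apply: span_ind => // v; case/mapP => i; rewrite mem_iota => lt_in ->.
exact: PDi.
Qed.

Lemma spanD_sub m n : (m <= n)%N -> (spanD m <= spanD n)%VS.
Proof.
move=> le_mn; apply/subvP; apply: spanD_ind => [|x u v|i lt_im].
- exact: mem0v.
- by move=> uS vS; rewrite memvD ?memvZ.
- by apply: mem_spanD; apply: leq_trans le_mn.
Qed.

Lemma comp_spanD n v : (n <= d)%N -> v \in spanD n -> (A \o v)%VF \in spanD n.+1.
Proof.
move=> le_nd; move: v; apply: spanD_ind => [|x u v Au Av|i lt_in].
- by rewrite comp_lfun0r mem0v.
- by rewrite comp_lfunDr -comp_lfunZr memvD ?memvZ.
- have lt_id : (i < d)%N by apply: leq_trans le_nd.
  rewrite three_term ?(ltnW lt_id) // lt_id !memvD ?memvZ ?mem_spanD //.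
    by apply: ltnW.
  case: ifP => [i0|_]; last exact: mem0v.
  by rewrite memvZ ?mem_spanD // ltnS (leq_trans (leq_pred i)) // ltnW.
Qed.

Lemma comp_spanD_top v : v \in spanD d.+1 -> (A \o v)%VF \in spanD d.+1.
Proof.
move: v; apply: spanD_ind => [|x u v Au Av|i le_id].
- by rewrite comp_lfun0r mem0v.
- by rewrite comp_lfunDr -comp_lfunZr memvD ?memvZ.
- rewrite three_term // !memvD //.
  + by case: ifP => [lt_id|_]; rewrite ?mem0v ?memvZ ?mem_spanD.
  + by rewrite memvZ ?mem_spanD.
  + case: ifP => [i0|_]; last exact: mem0v.
    by rewrite memvZ ?mem_spanD // ltnS (leq_trans (leq_pred i)).
Qed.

(** Only the term c_(i+1) D_(i+1) of the recurrence leaves the span of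
    D_0, ..., D_i, so each multiplication by A contributes one factor c. *)
Lemma opow_lead i : (i <= d)%N -> opow A i - gamma i *: D i \in spanD i.
Proof.
elim: i => [_|i IH lt_id]; first by rewrite big_ord0 scale1r D0 subrr mem0v.
have := comp_spanD (ltnW lt_id) (IH (ltnW lt_id)).
rewrite comp_lfunDr comp_lfunNr -comp_lfunZr three_term ?(ltnW lt_id) // lt_id.
rewrite big_ord_recr /= -/(opow A i.+1) -addrA.
set r := _ + (if _ then _ else _) => IS.
have rS : r \in spanD i.+1.
  rewrite memvD ?memvZ ?mem_spanD //; case: ifP => [i0|_]; last exact: mem0v.
  by rewrite memvZ ?mem_spanD // ltnS leq_pred.
have := memvD IS (memvZ (gamma i) rS).
by rewrite scalerDr opprD addrA subrK scalerA.
Qed.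

Lemma gamma_neq0 i : (i <= d)%N -> gamma i != 0.
Proof.
by move=> le_id; apply/prodf_neq0 => k _; rewrite c_neq0 // (leq_trans _ le_id).
Qed.

(** Schur multiplication by D_k is the projection onto the line of D_k. *)
Lemma schur_spanD_sum i v : (i <= d.+1)%N -> v \in spanD i ->
  \sum_(k < i) schur v (D k) = v.
Proof.
move=> le_id; move: v; apply: spanD_ind => [|x u v Eu Ev|k lt_ki].
- by rewrite big1 // => k _; rewrite schur0l.
- rewrite -{2}Eu -{2}Ev scaler_sumr -big_split; apply: eq_bigr => k _.
  by rewrite schurDl schurZl.
- have le_d (j : 'I_i) : (j <= d)%N by rewrite -ltnS (leq_trans _ le_id).
  rewrite (bigD1 (Ordinal lt_ki)) //= schur_idempotents ?(le_d (Ordinal lt_ki)) // eqxx.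
  rewrite big1 ?addr0 // => j; rewrite -val_eqE /= eq_sym => /negPf ne.
  by rewrite schur_idempotents ?(le_d (Ordinal lt_ki)) ?le_d // ne.
Qed.

(** Subtracting the Schur products with the earlier classes removes precisely the
    lower terms of A^i. *)
Lemma distance_num_lead i : (i <= d)%N ->
  distance_num A (mkseq D i) i = gamma i *: D i.
Proof.
move=> le_id; rewrite /distance_num big_map -[X in iota 0 X]subn0.
rewrite -/(index_iota 0 i) big_mkord.
have /(schur_spanD_sum (leqW le_id)) := opow_lead le_id.
set v := _ - gamma i *: D i => sum_v.
have -> : opow A i = v + gamma i *: D i by rewrite /v subrK.
rewrite addrC -[RHS](addKr v); congr (- _ + _); rewrite -[RHS]sum_v.
apply: eq_bigr => k _.
rewrite schurDl schurZl schur_idempotents //; last exact: ltnW (leq_trans _ le_id).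
by rewrite gtn_eqF ?ltn_ord // scaler0 addr0.
Qed.

Lemma schur_lead x i : (i <= d)%N -> schur (x *: D i) (x *: D i) = x ^+ 2 *: D i.
Proof. by move=> le_id; rewrite schurZl schurZr schur_idempotents // eqxx scalerA. Qed.

(** The factor beta is the leading coefficient g, since
    g^2 psi(D_i 1) / (g psi(D_i 1)) = g. *)
Lemma distance_opsE i : (i <= d.+1)%N -> distance_ops A i = mkseq D i.
Proof.
elim: i => [//|i IH] le_id; rewrite mkseqS /= IH ?(ltnW le_id) //; congr rcons.
case: i le_id {IH} => [|[|i]] le_id; [by rewrite D0 | by rewrite D1 |].
rewrite distance_num_lead // /beta schur_lead // !scale_lfunE !linearZ /=.
set g := gamma _; set p := psi Y _.
have g0 : g != 0 by apply: gamma_neq0.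
have p0 : p != 0 by apply: psi_idempotent.
by rewrite scalerA -[RHS]scale1r; congr (_ *: _); field; rewrite p0 g0.
Qed.

Lemma distance_opE i : (i <= d)%N -> distance_op A i = D i.
Proof. by move=> le_id; rewrite /distance_op distance_opsE // nth_mkseq. Qed.

Lemma idempotent_neq0 i : (i <= d)%N -> D i != 0.
Proof.
move/psi_idempotent; apply: contraNneq => ->.
by rewrite zero_lfunE linear0.
Qed.

Lemma idempotents_free : free (mkseq D d.+1).
Proof.
have sz : size (mkseq D d.+1) == d.+1 by rewrite size_mkseq.
apply/(@freeP _ _ _ (Tuple sz)) => k k0 i.
have le_id : (i <= d)%N by rewrite -ltnS.
have : \sum_(j < d.+1) k j *: D j = 0.
  by rewrite -[RHS]k0; apply: eq_bigr => j _; rewrite /= nth_mkseq.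
move/(congr1 (fun v => schur v (D i))); rewrite schur0l.
have schur_sum (I : Type) (s : seq I) (F : I -> 'End(Y)) v :
    schur (\sum_(j <- s) F j) v = \sum_(j <- s) schur (F j) v.
  by elim/big_rec2: _ => [|j y x _ <-]; rewrite ?schur0l ?schurDl.
rewrite schur_sum (bigD1 i) //= schurZl schur_idempotents // eqxx big1 ?addr0 => [/eqP|j].
  by rewrite scaler_eq0 (negPf (idempotent_neq0 le_id)) orbF => /eqP.
rewrite -val_eqE /= => /negPf ne.
by rewrite schurZl schur_idempotents ?ne ?scaler0 // -ltnS.
Qed.

(** The triangular system of opow_lead can be inverted because its diagonal
    entries are nonzero. *)
Lemma idempotent_in_power_span i : (i <= d)%N -> D i \in power_span A d.
Proof.
elim/ltn_ind: i => i IH le_id.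
have oS : opow A i \in power_span A d.
  by apply: memv_span; apply/mapP; exists i; rewrite ?mem_iota.
have lS : opow A i - gamma i *: D i \in power_span A d.
  move: (opow A i - _) (opow_lead le_id); apply: spanD_ind => [|x u v uS vS|k lt_ki].
  - exact: mem0v.
  - by rewrite memvD ?memvZ.
  - by apply: IH => //; apply: ltnW (leq_trans lt_ki le_id).
have := memvZ (gamma i)^-1 (memvB oS lS).
by rewrite opprB addrC subrK scalerA mulVf ?gamma_neq0 // scale1r.
Qed.

Lemma power_spanE : power_span A d = spanD d.+1.
Proof.
apply: subv_anti; apply/andP; split; apply/subvP.
  apply: span_ind => [|x u v uS vS|v]; first exact: mem0v.
    by rewrite memvD ?memvZ.
  case/mapP => i; rewrite mem_iota => /andP[_ le_id] ->.
  rewrite -(subrK (gamma i *: D i) (opow A i)) memvD ?memvZ ?mem_spanD //.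
  have le : (i <= d)%N by [].
  exact: subvP (spanD_sub (leqW le)) _ (opow_lead le).
by apply: spanD_ind => [|x u v uS vS|i lt_id]; rewrite ?mem0v ?memvD ?memvZ ?idempotent_in_power_span.
Qed.

(** Closure under composition is checked on powers of A in the left factor, where
    the three-term recurrence applies. *)
Lemma schur_system_coherent : quantum_coherent (power_span A d).
Proof.
rewrite power_spanE; split.
- by rewrite -D0 mem_spanD.
- by rewrite -sum_idempotents memv_suml // => i _; rewrite mem_spanD.
- move=> U V US VS; move: US; rewrite -{1}power_spanE; move: U.
  apply: span_ind => [|x u v uS vS|U].
  + by rewrite comp_lfun0l mem0v.
  + by rewrite comp_lfunDl -comp_lfunZl memvD ?memvZ.
  case/mapP => i _ ->; elim: i => [|i IH] /=; first by rewrite comp_lfun1l.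
  by rewrite -comp_lfunA comp_spanD_top.
- move=> U V US VS; move: U US; apply: spanD_ind => [|x u v uS vS|i le_id].
  + by rewrite schur0l mem0v.
  + by rewrite schurDl schurZl memvD ?memvZ.
  move: V VS; apply: spanD_ind => [|x u v uS vS|j le_jd].
  + by rewrite schur0r mem0v.
  + by rewrite schurDr schurZr memvD ?memvZ.
  + by rewrite schur_idempotents //; case: ifP => _; rewrite ?mem0v ?mem_spanD.
- apply: spanD_ind => [|x u v uS vS|i le_id].
  + by rewrite oadj0 mem0v.
  + by rewrite oadj_linear memvD ?memvZ.
  + by rewrite oadj_idempotent ?mem_spanD.
- apply: spanD_ind => [|x u v uS vS|i le_id].
  + by rewrite ostar0 mem0v.
  + by rewrite ostar_linear memvD ?memvZ.
  + by rewrite ostar_idempotent ?mem_spanD.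
Qed.

Lemma schur_system_graph : quantum_graph A.
Proof. by rewrite -D1; split; rewrite ?schur_idempotents ?ostar_idempotent. Qed.

Lemma schur_system_regular : distance_regular A d.
Proof.
split; [exact: schur_system_graph | | exact: schur_system_coherent].
by rewrite power_spanE; have /eqP := idempotents_free; rewrite size_mkseq.
Qed.

Lemma schur_system_array : intersection_array A d b c.
Proof.
split=> //; try exact: schur_system_regular.
- by split; [exact: schur_system_graph | | |]; rewrite -?D0 -D1 ?oadj_idempotent ?schur_idempotents.
- move=> U V; rewrite power_spanE => US VS.
  move: U US; apply: spanD_ind => [|x u v uS vS|i le_id].
  + by rewrite schur0l schur0r.
  + by rewrite schurDl schurDr schurZl schurZr uS vS.
  move: V VS; apply: spanD_ind => [|x u v uS vS|j le_jd].
  + by rewrite schur0l schur0r.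
  + by rewrite schurDl schurDr schurZl schurZr uS vS.
  + by rewrite !schur_idempotents // eq_sym; case: eqP => [->|].
- move=> i /andP[_ le_id]; rewrite distance_opsE ?leqW // distance_num_lead //=.
  rewrite schur_lead // !scale_lfunE !linearZ /=.
  by split; rewrite mulf_neq0 ?expf_neq0 ?gamma_neq0 ?psi_idempotent.
- exists a; split=> // i le_id; rewrite distance_opE // three_term //.
  congr (_ + _ + _); case: ifP => // lt; rewrite distance_opE //.
  exact: leq_trans (leq_pred i) le_id.
Qed.


End SchurIdempotents.

(** * The two halves of a quantum Hadamard matrix *)

Section HadamardMatrix.
Variables (C : numClosedFieldType) (X : quantum_space C).
Implicit Types (A B H : 'End(X)).
Local Notation N := (qdim X).
Local Notation J := (opJ X).
Local Notation plus := hadamard_plus.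
Local Notation minus := hadamard_minus.

Lemma opJ_offdiag : (J \o (J - \1))%VF = (N - 1) *: J.
Proof.
by rewrite comp_lfunDr comp_lfunNr comp_lfun1r opJ_comp scalerBl scale1r.
Qed.

Lemma hadamard_minusE H : minus H = plus (- H).
Proof. by []. Qed.

Lemma hadamard_plusN H : plus H = minus (- H).
Proof. by rewrite /hadamard_minus opprK. Qed.

Lemma half_double (V : lmodType C) (v : V) : 2^-1 *: (v + v) = v.
Proof. by rewrite -mulr2n -scaler_nat scalerA mulVf ?pnatr_eq0 ?scale1r. Qed.

Lemma add_plus_minus H : plus H + minus H = J.
Proof. by rewrite -scalerDr addrACA subrr addr0 half_double. Qed.

Lemma add_minus_plus H : minus H + plus H = J.
Proof. by rewrite addrC add_plus_minus. Qed.

(** The mixed terms J B and A J cancel. *)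
Lemma plus_minus_comp A B :
  ((plus A \o plus B) + (minus A \o minus B))%VF = 2^-1 *: ((J \o J) + (A \o B))%VF.
Proof.
rewrite -!comp_lfunZl -!comp_lfunZr !comp_lfunDl !comp_lfunDr.
rewrite !comp_lfunNl !comp_lfunNr opprK -!scalerDr; congr (_ *: _).
rewrite -[RHS]half_double; congr (_ *: _).
set x := (J \o J)%VF; set y := (J \o B)%VF; set z := (A \o J)%VF.
set w := (A \o B)%VF.
by rewrite addrACA [x + y + _]addrACA [z + w + _]addrACA !subrr addr0 add0r addrACA.
Qed.

Lemma oadj_plus H : oadj (plus H) = plus (oadj H).
Proof. by rewrite oadjZ oadjD oadj_J fmorphV rmorph_nat. Qed.

Lemma oadj_minus H : oadj (minus H) = minus (oadj H).
Proof. by rewrite oadjZ oadjB oadj_J fmorphV rmorph_nat. Qed.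

Lemma hadamard_oadj H : quantum_hadamard H -> quantum_hadamard (oadj H).
Proof.
case=> sH ssH HH HH'; split; rewrite ?oadjK //.
  by rewrite ostar_adj sH.
by rewrite -schur_adj ssH oadj_J.
Qed.

Section Hadamard.
Variable H : 'End(X).
Hypothesis hadH : quantum_hadamard H.
Local Notation P := (plus H).
Local Notation M := (minus H).

Lemma ostar_plus : ostar P = P.
Proof. by rewrite ostarZ ostarD ostar_J fmorphV rmorph_nat (hadamard_star hadH). Qed.

Lemma ostar_minus : ostar M = M.
Proof. by rewrite ostarZ ostarB ostar_J fmorphV rmorph_nat (hadamard_star hadH). Qed.

Lemma schur_plus : schur P P = P.
Proof.
rewrite schurZl schurZr schurDl !schurDr !schur_Jl schur_Jr (hadamard_schur hadH).
by rewrite [H + J]addrC half_double.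
Qed.

Lemma schur_minus : schur M M = M.
Proof.
rewrite schurZl schurZr schurBl !schurBr !schur_Jl schur_Jr (hadamard_schur hadH).
by rewrite -[H - J]opprB opprK half_double.
Qed.

Lemma schur_plus_minus : schur P M = 0.
Proof.
rewrite schurZl schurZr schurDl !schurBr !schur_Jl schur_Jr (hadamard_schur hadH).
by rewrite -[H - J]opprB subrr !scaler0.
Qed.

Lemma schur_minus_plus : schur M P = 0.
Proof.
rewrite schurZl schurZr schurBl !schurDr !schur_Jl schur_Jr (hadamard_schur hadH).
by rewrite [H + J]addrC subrr !scaler0.
Qed.

Lemma hadamard_comp_same :
  ((P \o oadj P) + (M \o oadj M))%VF = N *: \1%VF + (N / 2) *: (J - \1%VF).
Proof.
rewrite oadj_plus oadj_minus plus_minus_comp opJ_comp (hadamard_mulr hadH).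
rewrite -[N *: J + _]scalerDr scalerA [2^-1 * N]mulrC scalerBr scalerDr.
have -> : N *: \1%VF = (N / 2) *: \1%VF + (N / 2) *: \1%VF :> 'End(X).
  by rewrite -scalerDl; congr (_ *: _); field.
by rewrite [RHS]addrC addrA subrK.
Qed.

(** Exchanging the halves of the adjoint amounts to replacing it by its
    opposite, which changes the sign of H H^dagger in plus_minus_comp. *)
Lemma hadamard_comp_cross :
  ((P \o oadj M) + (M \o oadj P))%VF = (N / 2) *: (J - \1%VF).
Proof.
rewrite oadj_plus oadj_minus [in plus (oadj H)]hadamard_plusN.
rewrite [minus (oadj H) in X in X + _]hadamard_minusE plus_minus_comp comp_lfunNr.
by rewrite opJ_comp (hadamard_mulr hadH) -scalerBr scalerA [2^-1 * N]mulrC.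
Qed.

End Hadamard.

End HadamardMatrix.

(** * The quantum Hadamard graph *)

Section HadamardGraph.
Variables (C : numClosedFieldType) (X : quantum_space C).
Local Notation N := (qdim X).
Local Notation J := (opJ X).
Local Notation plus := hadamard_plus.
Local Notation minus := hadamard_minus.

(** The distance classes of the Hadamard graph: class 2 relates the points of a
    half that are neither equal nor antipodal, and class 4 is the antipodal
    operator. *)
Definition hadamard_class (H : 'End(X)) (i : nat) : 'End(hadamard_space X) :=
  match i with
  | 0 => \1%VF
  | 1 => hadamard_graph H
  | 2 => let K := (J - \1)%VF in
         block_op (block_op K K K K) 0 0 (block_op K K K K)
  | 3 => hadamard_graph (- H)
  | _ => block_op (block_op 0 \1%VF \1%VF 0) 0 0 (block_op 0 \1%VF \1%VF 0)
  end.

Lemma hadamard_graphN (H : 'End(X)) : hadamard_graph (- H) =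
  block_op 0 (block_op (minus H) (plus H) (plus H) (minus H))
    (block_op (oadj (minus H)) (oadj (plus H)) (oadj (plus H)) (oadj (minus H))) 0.
Proof. by rewrite /hadamard_graph -!hadamard_minusE -hadamard_plusN. Qed.

Lemma hadamard_space_id : \1%VF =
  block_op (block_op \1%VF 0 0 \1%VF) 0 0 (block_op \1%VF 0 0 \1%VF)
  :> 'End(hadamard_space X).
Proof. by rewrite !block_id. Qed.

Variable H : 'End(X).
Hypothesis hadH : quantum_hadamard H.
Local Notation D := (hadamard_class H).
Local Notation P := (plus H).
Local Notation M := (minus H).

Lemma hadamard_comps :
  (((P \o oadj P) + (M \o oadj M))%VF = N *: \1%VF + (N / 2) *: (J - \1%VF)) *
  (((M \o oadj M) + (P \o oadj P))%VF = N *: \1%VF + (N / 2) *: (J - \1%VF)) *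
  (((P \o oadj M) + (M \o oadj P))%VF = (N / 2) *: (J - \1%VF)) *
  (((M \o oadj P) + (P \o oadj M))%VF = (N / 2) *: (J - \1%VF)) *
  (((oadj P \o P) + (oadj M \o M))%VF = N *: \1%VF + (N / 2) *: (J - \1%VF)) *
  (((oadj M \o M) + (oadj P \o P))%VF = N *: \1%VF + (N / 2) *: (J - \1%VF)) *
  (((oadj P \o M) + (oadj M \o P))%VF = (N / 2) *: (J - \1%VF)) *
  (((oadj M \o P) + (oadj P \o M))%VF = (N / 2) *: (J - \1%VF)).
Proof.
have hadH' := hadamard_oadj hadH.
have same := hadamard_comp_same hadH; have cross := hadamard_comp_cross hadH.
have := hadamard_comp_cross hadH'; have := hadamard_comp_same hadH'.
rewrite -!oadj_plus -!oadj_minus !oadjK => same' cross'.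
by do !split=> //; rewrite addrC.
Qed.


Let hadamard_classE :=
  (hadamard_space_id : D 0 = _, erefl _ : D 1 = block_op _ _ _ _,
   erefl _ : D 2 = block_op _ _ _ _, hadamard_graphN H : D 3 = _,
   erefl _ : D 4 = block_op _ _ _ _).

Lemma schur_offdiag_id : schur (J - \1)%VF \1%VF = 0 /\ schur \1%VF (J - \1)%VF = 0 :> 'End(X).
Proof. by rewrite schurBl schurBr schur_Jl schur_Jr schur_id subrr. Qed.

Lemma schur_offdiag : schur (J - \1)%VF (J - \1)%VF = (J - \1)%VF :> 'End(X).
Proof. by rewrite schurBr schur_Jr (proj1 schur_offdiag_id) subr0. Qed.

Lemma schur_hadamard_class i j : (i <= 4)%N -> (j <= 4)%N ->
  schur (D i) (D j) = if i == j then D i else 0.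
Proof.
have [K1 K1'] := schur_offdiag_id; have KK := schur_offdiag.
have PP := schur_plus hadH; have MM := schur_minus hadH.
have PM := schur_plus_minus hadH; have MP := schur_minus_plus hadH.
pose schurs := (schur_block, schur0l, schur0r, schur_id, K1, K1', KK, PP, MM, PM, MP).
have block0 (Z : quantum_space C) : block_op 0 0 0 0 = 0 :> 'End(qsum Z Z).
  by apply/lfunP => u; rewrite block_opE !zero_lfunE !addr0.
case: i => [|[|[|[|[|//]]]]] _; case: j => [|[|[|[|[|//]]]]] _ /=;
  rewrite ?hadamard_space_id ?hadamard_graphN /hadamard_graph;
  by rewrite !schurs -?schur_adj ?schurs ?oadj0 ?block0.
Qed.

Lemma oadj_hadamard_class i : (i <= 4)%N -> oadj (D i) = D i.
Proof.
case: i => [|[|[|[|[|//]]]]] _ /=; rewrite ?oadj_id ?hadamard_graphN /hadamard_graph //;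
  by rewrite !oadj_block ?oadj0 ?oadjK ?oadjB ?oadj_J ?oadj_id.
Qed.

Lemma ostar_hadamard_class i : (i <= 4)%N -> ostar (D i) = D i.
Proof.
have sP := ostar_plus hadH; have sM := ostar_minus hadH.
case: i => [|[|[|[|[|//]]]]] _ /=; rewrite ?ostar_id ?hadamard_graphN /hadamard_graph //;
  by rewrite !ostar_block ?ostar0 ?ostar_adj ?sP ?sM ?ostarB ?ostar_J ?ostar_id.
Qed.

Lemma sum_hadamard_class : \sum_(i < 5) D i = opJ (hadamard_space X).
Proof.
have -> : \sum_(i < 5) D i = D 0 + D 1 + D 2 + D 3 + D 4.
  by rewrite !big_ord_recr big_ord0 /= add0r.
rewrite !hadamard_classE !add_block !(add0r, addr0) !add_block !(add0r, addr0).
rewrite -!oadjD add_plus_minus add_minus_plus oadj_J.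
by rewrite [\1%VF + _]addrC subrK !block_J.
Qed.

Lemma psi_hadamard_class i :
  N != 1 -> (i <= 4)%N -> psi (hadamard_space X) (D i 1) != 0.
Proof.
move=> N1 le_i4; have N0 := qdim_neq0 X.
have psi0 : psi X ((0 : 'End(X)) 1) = 0 by rewrite zero_lfunE linear0.
have psi00 : psi (qsum X X) ((0 : 'End(qsum X X)) 1) = 0 by rewrite zero_lfunE linear0.
have psi1 : psi X ((\1%VF : 'End(X)) 1) = N by rewrite id_lfunE.
have psiJ : psi X (J 1) = N * N by rewrite opJE linearZ.
have psiK : psi X ((J - \1)%VF 1) = N * (N - 1).
  by rewrite add_lfunE opp_lfunE linearB /= psiJ psi1; ring.
have psiPM G : psi X (plus G 1) + psi X (minus G 1) = N * N.
  by rewrite -linearD -add_lfunE add_plus_minus psiJ.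
have psiPM' G : psi X (minus G 1) + psi X (plus G 1) = N * N by rewrite addrC.
have neq0 (y x : C) : x = 4 * y -> y != 0 -> x != 0.
  by move=> -> y0; rewrite mulf_neq0 ?pnatr_eq0.
case: i le_i4 => [|[|[|[|[|//]]]]] _; rewrite hadamard_classE !psi_block.
- by rewrite psi0 psi00 psi1; apply: (neq0 N) => //; ring.
- rewrite psi00 oadj_plus oadj_minus !psiPM !psiPM'.
  by apply: (neq0 (N * N)); [ring | rewrite mulf_neq0].
- rewrite psi00 psiK.
  by apply: (neq0 (2 * (N * (N - 1)))); [ring | rewrite !mulf_neq0 ?subr_eq0 ?pnatr_eq0].
- rewrite psi00 oadj_plus oadj_minus !psiPM !psiPM'.
  by apply: (neq0 (N * N)); [ring | rewrite mulf_neq0].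
- by rewrite psi0 psi00 psi1; apply: (neq0 N) => //; ring.
Qed.

Ltac block_simpl := rewrite !(comp_block, comp_lfun0l, comp_lfun0r, comp_lfun1r,
  @scale_block C (qsum X X), @scale_block C X, scaler0, add_block, add0r, addr0).

Lemma graph_comp0 : (D 1 \o D 0)%VF = D 1.
Proof. exact: comp_lfun1r. Qed.

Lemma graph_comp1 : (D 1 \o D 1)%VF = N *: D 0 + (N / 2) *: D 2.
Proof.
rewrite !hadamard_classE; block_simpl.
by rewrite !hadamard_comps.
Qed.

Lemma graph_comp2 : (D 1 \o D 2)%VF = (N - 1) *: D 3 + (N - 1) *: D 1.
Proof.
rewrite !hadamard_classE; block_simpl; rewrite oadj_plus oadj_minus.
rewrite -!comp_lfunDl !add_plus_minus !add_minus_plus opJ_offdiag.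
by rewrite -!(scalerDr (N - 1)) !add_plus_minus !add_minus_plus.
Qed.

Lemma graph_comp3 : (D 1 \o D 3)%VF = N *: D 4 + (N / 2) *: D 2.
Proof.
rewrite !hadamard_classE; block_simpl.
by rewrite !hadamard_comps.
Qed.

Lemma graph_comp4 : (D 1 \o D 4)%VF = D 3.
Proof.
rewrite !hadamard_classE; block_simpl.
by [].
Qed.

Lemma hadamard_class_rec i : (i <= 4)%N ->
  (hadamard_graph H \o D i)%VF =
    (if (i < 4)%N then [:: 1; N / 2; N - 1; N]`_i *: D i.+1 else 0)
    + (nseq 5 0)`_i *: D i
    + (if (0 < i)%N then [:: N; N - 1; N / 2; 1]`_i.-1 *: D i.-1 else 0).
Proof.
case: i => [|[|[|[|[|//]]]]] _.
- change (D 1 \o D 0 = 1 *: D 1 + 0 *: D 0 + 0)%VF.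
  by rewrite graph_comp0 scale1r scale0r !addr0.
- change (D 1 \o D 1 = (N / 2) *: D 2 + 0 *: D 1 + N *: D 0)%VF.
  by rewrite graph_comp1 scale0r addr0 addrC.
- change (D 1 \o D 2 = (N - 1) *: D 3 + 0 *: D 2 + (N - 1) *: D 1)%VF.
  by rewrite graph_comp2 scale0r addr0.
- change (D 1 \o D 3 = N *: D 4 + 0 *: D 3 + (N / 2) *: D 2)%VF.
  by rewrite graph_comp3 scale0r addr0.
- change (D 1 \o D 4 = 0 + 0 *: D 4 + 1 *: D 3)%VF.
  by rewrite graph_comp4 scale1r scale0r !add0r.
Qed.

Lemma hadamard_graph_array : N != 1 ->
  intersection_array (hadamard_graph H) 4
    [:: N; N - 1; N / 2; 1] [:: 1; N / 2; N - 1; N].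
Proof.
move=> N1.
have N0 := qdim_neq0 X.
have n2 : (2 : C) != 0 by rewrite pnatr_eq0.
(* The graph is bipartite, which makes every a_i vanish. *)
apply: (schur_system_array (D := D) (a := nseq 5 0)) => //.
- exact: schur_hadamard_class.
- by move=> i; apply: psi_hadamard_class.
- exact: sum_hadamard_class.
- exact: oadj_hadamard_class.
- exact: ostar_hadamard_class.
- case=> [|[|[|[|//]]]] _ /=; rewrite ?oner_neq0 ?subr_eq0 //.
  by rewrite mulf_neq0 ?invr_neq0.
- exact: hadamard_class_rec.
Qed.

End HadamardGraph.

Unset Implicit Arguments.

Theorem proposition3p18 (R : realType) (X : quantum_space R[i]) (H : 'End(X)) :
  let N := qdim X in
  N <> 3 -> N <> 1 ->
  quantum_hadamard H ->
  distance_regular (hadamard_graph H) 4 /\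
  intersection_array (hadamard_graph H) 4
    [:: N; N - 1; N / 2; 1] [:: 1; N / 2; N - 1; N].
Proof.
move=> N _ /eqP N1 hadH.
have arr := hadamard_graph_array hadH N1.
by split=> //; apply: array_distance_regular arr.
Qed.
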